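(* In the $D_4^{(1)}$ system (defined in the context) impose the condition $x=y$ and make the change of variables $X:=y$, $Y:=z$ from $x,y,z$ to $X,Y$. Then the $D_4^{(1)}$ system can also be written in the new variables $X,Y$ as a Hamiltonian system; this new system is $$\frac{dX}{dt}=\frac{\partial H}{\partial Y},\qquad \frac{dY}{dt}=-\frac{\partial H}{\partial X}$$ with the polynomial Hamiltonian $$\begin{aligned}H=-\frac{\eta-1}{2\eta}b(t)\Big[&-(X-1)(X-\eta)X^2Y^2-\{2\alpha_2(X-1)(X-\eta)-\alpha_0\eta(X-1)-\alpha_3(X-\eta)\}XY\\&-\alpha_2^2X^2+\alpha_2\{1-(\alpha_0+\alpha_1+\alpha_2+\alpha_4)+(1-(\alpha_1+\alpha_2+\alpha_3+\alpha_4))\eta\}X\Big].\end{aligned}$$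
   Context: The $D_4^{(1)}$ system. Let $\eta\in\mathbb{C}\setminus\{0\}$, let $b(t)\in\mathbb{C}(t)$ be nonzero, and let $\alpha_0,\dots,\alpha_4\in\mathbb{C}$ satisfy $\alpha_0+\alpha_1+2\alpha_2+\alpha_3+\alpha_4=1$. The $D_4^{(1)}$ system for unknown functions $x,y,z$ of $t$ is $$\frac{2\eta}{b(t)}\frac{dx}{dt}=P,\qquad -\frac{2\eta}{b(t)}\frac{dy}{dt}=Q,\qquad \frac{2\eta}{b(t)}\frac{dz}{dt}=R,$$ where $P=-2x(y-1)yz(x-\eta)(2x-2y+1-\eta)-2(2\alpha_0+2\alpha_1+4\alpha_2+\alpha_3+\alpha_4)x^3y-2(\alpha_0+\alpha_1)xy^3+(5\alpha_0+5\alpha_1+6\alpha_2+\alpha_3+\alpha_4)x^2y^2-\{5\alpha_0+5\alpha_1+6\alpha_2+2\alpha_3-3(2\alpha_0+2\alpha_1+4\alpha_2+\alpha_3+\alpha_4)\eta\}x^2y+\{3(\alpha_0+\alpha_1)-(4\alpha_0+6\alpha_1+6\alpha_2+\alpha_3+\alpha_4)\eta\}xy^2+x^4+2(\alpha_0+\alpha_1+2\alpha_2+\alpha_3-\eta)x^3+2\alpha_1\eta y^3+\{(\alpha_0+\alpha_1+2\alpha_2+\alpha_3)(\eta^2-3\eta+1)+\alpha_4\eta^2\}x^2+\alpha_1(\eta-3)\eta y^2+\{-(\alpha_0+\alpha_1)+2(2\alpha_0+3\alpha_1+3\alpha_2+\alpha_3)\eta-(2\alpha_0+2\alpha_1+4\alpha_2+\alpha_3+\alpha_4)\eta^2\}xy+(\alpha_0+\alpha_1+2\alpha_2+\alpha_3)(\eta-1)\eta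 x-\alpha_1(\eta-1)\eta y$, $Q=2x(y-1)yz(x-\eta)(2x-2y+1-\eta)-2(\alpha_3+\alpha_4)x^3y-2(\alpha_0+\alpha_1+4\alpha_2+2\alpha_3+2\alpha_4)xy^3+(\alpha_0+\alpha_1+6\alpha_2+5\alpha_3+5\alpha_4)x^2y^2+\{-(\alpha_0+\alpha_1+6\alpha_2+4\alpha_3+6\alpha_4)+3(\alpha_3+\alpha_4)\eta\}x^2y+\{3(\alpha_0+\alpha_1+4\alpha_2+2\alpha_3+2\alpha_4)-(2\alpha_0+6\alpha_2+5\alpha_3+5\alpha_4)\eta\}xy^2+y^4+2\alpha_4x^3+2\{(\alpha_0+2\alpha_2+\alpha_3+\alpha_4)\eta-1\}y^3-\alpha_4(3\eta-1)x^2+\{1-3(\alpha_0+2\alpha_2+\alpha_3+\alpha_4)\eta+(\alpha_0+2\alpha_2+\alpha_3+\alpha_4)\eta^2\}y^2+\{-(\alpha_0+\alpha_1+4\alpha_2+2\alpha_3+2\alpha_4)+2(\alpha_0+3\alpha_2+2\alpha_3+3\alpha_4)\eta-(\alpha_3+\alpha_4)\eta^2\}xy+\alpha_4(\eta-1)\eta x-(\alpha_0+2\alpha_2+\alpha_3+\alpha_4)(\eta-1)\eta y$, $R=(2x-2y+1-\eta)\{2x^2y+2xy^2-x^2-\eta y^2-2(\eta+1)xy+\eta(x+y)\}z^2+z\big[-2(\alpha_3+\alpha_4)x^3+2(\alpha_0+\alpha_1)y^3+2(\alpha_0+\alpha_1+6\alpha_2+2\alpha_3+2\alpha_4)x^2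y-2(2\alpha_0+2\alpha_1+6\alpha_2+\alpha_3+\alpha_4)xy^2+\{-(\alpha_0+\alpha_1+6\alpha_2+4\alpha_3)+3(\alpha_3+\alpha_4)\eta\}x^2+\{-3(\alpha_0+\alpha_1)+(4\alpha_0+6\alpha_2+\alpha_3+\alpha_4)\eta\}y^2-4\{-(\alpha_0+\alpha_1+3\alpha_2+\alpha_3)+(\alpha_0+3\alpha_2+\alpha_3+\alpha_4)\eta\}xy+\{-(\alpha_0+\alpha_1+4\alpha_2+2\alpha_3)+2(\alpha_0+3\alpha_2+2\alpha_3)\eta-(\alpha_3+\alpha_4)\eta^2\}x+\{\alpha_0+\alpha_1-2(2\alpha_0+3\alpha_2+\alpha_3)\eta+(2\alpha_0+4\alpha_2+\alpha_3+\alpha_4)\eta^2\}y-(\alpha_0+2\alpha_2+\alpha_3)(\eta-1)\eta\big]+\alpha_2\big[(\alpha_0+\alpha_1+2\alpha_2-\alpha_3-\alpha_4)x^2+(\alpha_0+\alpha_1-2\alpha_2-\alpha_3-\alpha_4)y^2-2(\alpha_0+\alpha_1-\alpha_3-\alpha_4)xy+\{\alpha_0+\alpha_1-2\alpha_3-(2\alpha_0+2\alpha_2-\alpha_3-\alpha_4)\eta\}x+\{-\alpha_0-\alpha_1+2\alpha_2+2\alpha_3+(2\alpha_0-\alpha_3-\alpha_4)\eta\}y+(\eta-1)(\alpha_2+\alpha_3+(\alpha_0+\alpha_2)\eta)\big]$. *)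

(* Defs.v *)
From HB Require Import structures.
From mathcomp Require Import all_boot all_order all_algebra.
From mathcomp Require Import fraction polyXY complex.
From mathcomp Require Import boolp classical_sets reals topology normedtype derive.
Set Implicit Arguments.
Unset Strict Implicit.
Unset Printing Implicit Defensive.
Import Order.TTheory GRing.Theory Num.Theory.
Import numFieldNormedType.Exports.
Local Open Scope classical_set_scope.
Local Open Scope ring_scope.

(* An element of [F(t)] is evaluated through a reduced representative, so that
   the zeros of [ratfun_den b] are exactly the poles of [b]. *)
Definition ratfun_num (F : fieldType) (b : {fraction {poly F}}) : {poly F} :=
  let n := \n_(repr b) in let d := \d_(repr b) in n %/ gcdp n d.

Definition ratfun_den (F : fieldType) (b : {fraction {poly F}}) : {poly F} :=
  let n := \n_(repr b) in let d := \d_(repr b) in d %/ gcdp n d.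

Definition ratfun_eval (F : fieldType) (b : {fraction {poly F}}) (t : F) : F :=
  (ratfun_num b).[t] / (ratfun_den b).[t].

Definition D4_P (F : fieldType) (eta a0 a1 a2 a3 a4 x y z : F) : F :=
  - 2 * x * (y - 1) * y * z * (x - eta) * (2 * x - 2 * y + 1 - eta)
  - 2 * (2 * a0 + 2 * a1 + 4 * a2 + a3 + a4) * x ^+ 3 * y
  - 2 * (a0 + a1) * x * y ^+ 3
  + (5 * a0 + 5 * a1 + 6 * a2 + a3 + a4) * x ^+ 2 * y ^+ 2
  - (5 * a0 + 5 * a1 + 6 * a2 + 2 * a3
     - 3 * (2 * a0 + 2 * a1 + 4 * a2 + a3 + a4) * eta) * x ^+ 2 * y
  + (3 * (a0 + a1) - (4 * a0 + 6 * a1 + 6 * a2 + a3 + a4) * eta) * x * y ^+ 2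
  + x ^+ 4
  + 2 * (a0 + a1 + 2 * a2 + a3 - eta) * x ^+ 3
  + 2 * a1 * eta * y ^+ 3
  + ((a0 + a1 + 2 * a2 + a3) * (eta ^+ 2 - 3 * eta + 1) + a4 * eta ^+ 2)
    * x ^+ 2
  + a1 * (eta - 3) * eta * y ^+ 2
  + (- (a0 + a1) + 2 * (2 * a0 + 3 * a1 + 3 * a2 + a3) * eta
     - (2 * a0 + 2 * a1 + 4 * a2 + a3 + a4) * eta ^+ 2) * x * y
  + (a0 + a1 + 2 * a2 + a3) * (eta - 1) * eta * x
  - a1 * (eta - 1) * eta * y.

Definition D4_Q (F : fieldType) (eta a0 a1 a2 a3 a4 x y z : F) : F :=
  2 * x * (y - 1) * y * z * (x - eta) * (2 * x - 2 * y + 1 - eta)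
  - 2 * (a3 + a4) * x ^+ 3 * y
  - 2 * (a0 + a1 + 4 * a2 + 2 * a3 + 2 * a4) * x * y ^+ 3
  + (a0 + a1 + 6 * a2 + 5 * a3 + 5 * a4) * x ^+ 2 * y ^+ 2
  + (- (a0 + a1 + 6 * a2 + 4 * a3 + 6 * a4) + 3 * (a3 + a4) * eta)
    * x ^+ 2 * y
  + (3 * (a0 + a1 + 4 * a2 + 2 * a3 + 2 * a4)
     - (2 * a0 + 6 * a2 + 5 * a3 + 5 * a4) * eta) * x * y ^+ 2
  + y ^+ 4
  + 2 * a4 * x ^+ 3
  + 2 * ((a0 + 2 * a2 + a3 + a4) * eta - 1) * y ^+ 3
  - a4 * (3 * eta - 1) * x ^+ 2
  + (1 - 3 * (a0 + 2 * a2 + a3 + a4) * eta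
     + (a0 + 2 * a2 + a3 + a4) * eta ^+ 2) * y ^+ 2
  + (- (a0 + a1 + 4 * a2 + 2 * a3 + 2 * a4)
     + 2 * (a0 + 3 * a2 + 2 * a3 + 3 * a4) * eta
     - (a3 + a4) * eta ^+ 2) * x * y
  + a4 * (eta - 1) * eta * x
  - (a0 + 2 * a2 + a3 + a4) * (eta - 1) * eta * y.

Definition D4_R (F : fieldType) (eta a0 a1 a2 a3 a4 x y z : F) : F :=
  (2 * x - 2 * y + 1 - eta)
  * (2 * x ^+ 2 * y + 2 * x * y ^+ 2 - x ^+ 2 - eta * y ^+ 2
     - 2 * (eta + 1) * x * y + eta * (x + y)) * z ^+ 2
  + z * (- 2 * (a3 + a4) * x ^+ 3
         + 2 * (a0 + a1) * y ^+ 3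
         + 2 * (a0 + a1 + 6 * a2 + 2 * a3 + 2 * a4) * x ^+ 2 * y
         - 2 * (2 * a0 + 2 * a1 + 6 * a2 + a3 + a4) * x * y ^+ 2
         + (- (a0 + a1 + 6 * a2 + 4 * a3) + 3 * (a3 + a4) * eta) * x ^+ 2
         + (- 3 * (a0 + a1) + (4 * a0 + 6 * a2 + a3 + a4) * eta) * y ^+ 2
         - 4 * (- (a0 + a1 + 3 * a2 + a3) + (a0 + 3 * a2 + a3 + a4) * eta)
           * x * y
         + (- (a0 + a1 + 4 * a2 + 2 * a3)
            + 2 * (a0 + 3 * a2 + 2 * a3) * eta
            - (a3 + a4) * eta ^+ 2) * x
         + (a0 + a1 - 2 * (2 * a0 + 3 * a2 + a3) * eta
            + (2 * a0 + 4 * a2 + a3 + a4) * eta ^+ 2) * y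
         - (a0 + 2 * a2 + a3) * (eta - 1) * eta)
  + a2 * ((a0 + a1 + 2 * a2 - a3 - a4) * x ^+ 2
          + (a0 + a1 - 2 * a2 - a3 - a4) * y ^+ 2
          - 2 * (a0 + a1 - a3 - a4) * x * y
          + (a0 + a1 - 2 * a3 - (2 * a0 + 2 * a2 - a3 - a4) * eta) * x
          + (- a0 - a1 + 2 * a2 + 2 * a3 + (2 * a0 - a3 - a4) * eta) * y
          + (eta - 1) * (a2 + a3 + (a0 + a2) * eta)).

(* [R[i]^o] is the complex plane as a normed space over itself, so [derivable]
   and [derive1] below are complex differentiability and d/dt. *)
Definition D4_system (R : realType) (eta a0 a1 a2 a3 a4 : R[i])
    (b : {fraction {poly R[i]}}) (U : set R[i]^o) (x y z : R[i]^o -> R[i]^o) :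
    Prop :=
  forall t : R[i]^o, U t ->
    [/\ derivable x t 1, derivable y t 1 & derivable z t 1] /\
    [/\ 2 * eta / ratfun_eval b t * derive1 x t
          = D4_P eta a0 a1 a2 a3 a4 (x t) (y t) (z t),
        - (2 * eta / ratfun_eval b t) * derive1 y t
          = D4_Q eta a0 a1 a2 a3 a4 (x t) (y t) (z t) &
        2 * eta / ratfun_eval b t * derive1 z t
          = D4_R eta a0 a1 a2 a3 a4 (x t) (y t) (z t)].

(* Bivariate polynomials in the convention of [polyXY]: in [{poly {poly F}}]
   the outer variable ['X] is X, the inner one ['Y] is Y, and [h.[x, y]] is the
   value at X = x, Y = y. *)
Definition dpolyX (F : fieldType) (h : {poly {poly F}}) : {poly {poly F}} :=
  deriv h.

Definition dpolyY (F : fieldType) (h : {poly {poly F}}) : {poly {poly F}} :=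
  map_poly (@deriv F) h.

(* [H t] is the polynomial (X, Y) |-> H(X, Y, t). *)
Definition hamiltonian_system (R : realType) (H : R[i] -> {poly {poly R[i]}})
    (U : set R[i]^o) (X Y : R[i]^o -> R[i]^o) : Prop :=
  forall t : R[i]^o, U t ->
    [/\ derivable X t 1, derivable Y t 1,
        derive1 X t = (dpolyY (H t)).[X t, Y t] &
        derive1 Y t = - (dpolyX (H t)).[X t, Y t]].

Definition cst2 (F : fieldType) (c : F) : {poly {poly F}} := c%:P%:P.

Definition D4_hamiltonian (F : fieldType) (eta a0 a1 a2 a3 a4 : F)
    (b : {fraction {poly F}}) (t : F) : {poly {poly F}} :=
  cst2 (- ((eta - 1) / (2 * eta)) * ratfun_eval b t) *
  (- ('X - 1) * ('X - cst2 eta) * 'X ^+ 2 * 'Y ^+ 2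
   - (cst2 (2 * a2) * ('X - 1) * ('X - cst2 eta)
      - cst2 (a0 * eta) * ('X - 1) - cst2 a3 * ('X - cst2 eta)) * 'X * 'Y
   - cst2 (a2 ^+ 2) * 'X ^+ 2
   + cst2 (a2 * (1 - (a0 + a1 + a2 + a4)
                 + (1 - (a1 + a2 + a3 + a4)) * eta)) * 'X).

(* Main.v *)
Require Import Defs.
From mathcomp Require Import all_boot all_order all_algebra.
From mathcomp Require Import fraction polyXY complex ring.
From mathcomp Require Import boolp classical_sets reals topology normedtype derive.
Import Order.TTheory GRing.Theory Num.Theory.
Import numFieldNormedType.Exports.
Local Open Scope classical_set_scope.
Local Open Scope ring_scope.

(** On the plane [x = y] the three right-hand sides collapse. First, [Q = - P]
    there ([D4_Q_diag]), so the second equation repeats the first; this is what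
    makes the condition [x = y] compatible with the system. Second, [P] and [R]
    restricted to the plane are [2 eta / b * dH/dY] and [- 2 eta / b * dH/dX]
    ([horner_dpolyY_D4] and [horner_dpolyX_D4]). These polynomial identities
    hold modulo the normalization [a0 + a1 + 2 a2 + a3 + a4 = 1]: for instance,
    the parameter-free monomial [x ^+ 4] of [P] cancels against the quartic
    monomials whose coefficients are linear in the parameters. Finally, the
    factor [2 eta / b(t)] is invertible on [U], where [b] has neither zeros nor
    poles, so at each point of [U] the two systems say the same about the
    derivatives. *)

(** The substitution [X := x] fixes ['Y], so it commutes with [d/dY]; after it
    the Hamiltonian is an ordinary polynomial in one variable. *)
Lemma horner_dpolyY (F : fieldType) (h : {poly {poly F}}) (x y : F) :
  (dpolyY h).[x, y] = (h.[x%:P])^`().[y].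
Proof.
rewrite /dpolyY; congr (_.[y]).
elim/poly_ind: h => [|h c IH]; first by rewrite map_poly0 !horner0 deriv0.
rewrite hornerMXaddC derivD derivM derivC mulr0 addr0 -IH.
have -> : map_poly (@deriv F) (h * 'X + c%:P) =
          map_poly (@deriv F) h * 'X + (c^`())%:P.
  apply/polyP => i; rewrite coef_map_id0 ?deriv0// !coefD !coefMX !coefC.
  by case: i => [|i] /=; rewrite ?add0r// !addr0 coef_map_id0 ?deriv0.
by rewrite hornerMXaddC.
Qed.

Section Diagonal.
Variables (F : fieldType) (eta a0 a1 a2 a3 a4 : F).
Hypothesis a_sum : a0 + a1 + 2 * a2 + a3 + a4 = 1.

Let a1E : a1 = 1 - a0 - 2 * a2 - a3 - a4.
Proof. by rewrite -[X in X - a0]a_sum; ring. Qed.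

(** The equations for [x] and for [y] become one, which is why no constraint
    survives from imposing [x = y]. *)
Lemma D4_Q_diag X Y :
  D4_Q eta a0 a1 a2 a3 a4 X X Y = - D4_P eta a0 a1 a2 a3 a4 X X Y.
Proof. by rewrite /D4_Q /D4_P a1E; ring. Qed.

(** The part of [P] linear in [z] carries the factor [2 x - 2 y + 1 - eta],
    which is the constant [1 - eta] on the plane; this is the source of the
    factor [eta - 1] in front of the Hamiltonian. *)
Lemma horner_dpolyY_D4 b X Y t :
  (dpolyY (D4_hamiltonian eta a0 a1 a2 a3 a4 b t)).[X, Y] =
  ratfun_eval b t / (2 * eta) * D4_P eta a0 a1 a2 a3 a4 X X Y.
Proof.
rewrite horner_dpolyY /D4_hamiltonian /cst2.
move: (ratfun_eval _ _) (2 * eta)^-1 => B c.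
rewrite !hornerE /= !poly.derivE /= !hornerE /=.
by rewrite /D4_P a1E; ring.
Qed.

Lemma horner_dpolyX_D4 b X Y t :
  (dpolyX (D4_hamiltonian eta a0 a1 a2 a3 a4 b t)).[X, Y] =
  - (ratfun_eval b t / (2 * eta) * D4_R eta a0 a1 a2 a3 a4 X X Y).
Proof.
rewrite /dpolyX /D4_hamiltonian /cst2.
move: (ratfun_eval _ _) (2 * eta)^-1 => B c.
rewrite !poly.derivE /= !hornerE /=.
by rewrite /D4_R a1E; ring.
Qed.

End Diagonal.

Theorem theorem3p3 (R : realType) (eta a0 a1 a2 a3 a4 : R[i])
    (b : {fraction {poly R[i]}})
    (eta_neq0 : eta != 0) (b_neq0 : b != 0)
    (a_sum : a0 + a1 + 2 * a2 + a3 + a4 = 1)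
    (U : set R[i]^o) (U_open : open U)
    (U_dom : forall t, U t ->
       (ratfun_num b).[t] != 0 /\ (ratfun_den b).[t] != 0)
    (x y z : R[i]^o -> R[i]^o) (xy : forall t, U t -> x t = y t) :
  D4_system eta a0 a1 a2 a3 a4 b U x y z <->
  hamiltonian_system (D4_hamiltonian eta a0 a1 a2 a3 a4 b) U y z.
Proof.
(* [x] and [y] have the same germ at each point of [U], as [U] is open. *)
have nearU t : U t -> \near t, y t = x t.
  move=> Ut; have : nbhs t U by apply: open_nbhs_nbhs.
  by apply: filterS => s /xy ->.
have k_neq0 t : U t -> 2 * eta / ratfun_eval b t != 0.
  case/U_dom => n0 d0.
  by rewrite !mulf_neq0 ?invr_neq0 ?mulf_neq0 ?invr_neq0 ?pnatr_eq0.
have solve t (d p : R[i]) : U t ->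
    2 * eta / ratfun_eval b t * d = p <-> d = ratfun_eval b t / (2 * eta) * p.
  move=> /k_neq0 k0; rewrite -[ratfun_eval b t / _]invf_div.
  by split=> [<-|->]; rewrite ?mulKf ?mulVKf.
split=> sys t Ut; have := sys t Ut.
- case=> -[dx dy dz] []; rewrite xy // D4_Q_diag // mulNr => _ /oppr_inj.
  move=> /solve-/(_ Ut) eqy /solve-/(_ Ut) eqz.
  by split=> //; rewrite ?horner_dpolyY_D4 // horner_dpolyX_D4 // opprK.
- rewrite horner_dpolyY_D4 // horner_dpolyX_D4 // opprK => -[dy dz].
  move=> /solve-/(_ Ut) eqy /solve-/(_ Ut) eqz.
  have dx : derivable x t 1 by apply: near_eq_derivable dy; exact: nearU.
  have x'E : derive1 x t = derive1 y t.
    by rewrite !derive1E; apply/esym/near_eq_derive/nearU.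
  split=> //; rewrite x'E xy // D4_Q_diag // mulNr; split=> //.
  by rewrite eqy.
Qed.
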